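(* Let $r$ be a nonnegative integer. Let $\mathbf{a}=(a_1,a_2,\ldots)$ be a sequence of real numbers with $a_1\neq 0$, let $A(t)=\sum_{j\ge1}a_j\frac{t^j}{j!}$, let $\overline{A}(t)=\sum_{j\ge1}\overline{a}_j\frac{t^j}{j!}$ be the compositional inverse of $A$, and $\overline{\mathbf{a}}=(\overline{a}_1,\overline{a}_2,\ldots)$. Let $\mathbf{b}=(b_1,b_2,\ldots)$ be a sequence of real numbers with $b_1\neq0$, let $B(t)=\sum_{j\ge0}b_{j+1}\frac{t^j}{j!}$, and let $(\mathbf{b}\circ\overline{\mathbf{a}})^{-1}=(c_1,c_2,\ldots)$ be the sequence defined by $\sum_{j\ge0}c_{j+1}\frac{t^j}{j!}=\big(B(\overline{A}(t))\big)^{-1}$. Then for sequences of real numbers $(U_n)_{n\ge0}$, $(V_n)_{n\ge0}$ the following inverse relations hold: $$U_n=\sum_{k=0}^{n}B^{(r)}_{n+r,k+r}(\mathbf{a};\mathbf{b})V_k\ \text{ for all } n\ge0 \iff V_n=\sum_{k=0}^{n}B^{(r)}_{n+r,k+r}\big(\overline{\mathbf{a}};(\mathbf{b}\circ\overline{\mathbf{a}})^{-1}\big)U_k\ \text{ for all } n\ge0,$$ i.e. for all integers $0\le j\le n$, $$\sum_{k=j}^{n}B^{(r)}_{n+r,k+r}(\mathbf{a};\mathbf{b})\,B^{(r)}_{k+r,j+r}\big(\overline{\mathbf{a}};(\mathbf{b}\circ\overline{\mathbf{a}})^{-1}\big)=\delta_{j,n}.$$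
   Context: For sequences $\mathbf{a}=(a_1,a_2,\ldots)$, $\mathbf{b}=(b_1,b_2,\ldots)$ and a nonnegative integer $r$, the partial $r$-Bell polynomials $B^{(r)}_{n+r,k+r}(\mathbf{a};\mathbf{b})$ ($n,k\ge0$) are defined by $$\sum_{n\ge k}B^{(r)}_{n+r,k+r}(\mathbf{a};\mathbf{b})\frac{t^n}{n!}=\frac{1}{k!}\Big(\sum_{j\ge1}a_j\frac{t^j}{j!}\Big)^k\Big(\sum_{j\ge0}b_{j+1}\frac{t^j}{j!}\Big)^r,$$ with $B^{(r)}_{n+r,k+r}(\mathbf{a};\mathbf{b})=0$ for $n<k$. $\delta_{j,n}$ is the Kronecker delta. *)

(* Defs.v *)
From mathcomp Require Import all_boot all_order all_algebra.
From mathcomp Require Import reals.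

Set Implicit Arguments.
Unset Strict Implicit.
Unset Printing Implicit Defensive.

Import Order.TTheory GRing.Theory Num.Theory.
Local Open Scope ring_scope.

(* Formal power series are represented by their ordinary coefficients:        *)
(* f : fps R stands for \sum_n (f n) t^n; equality is pointwise (=1).         *)
Definition fps (R : Type) : Type := nat -> R.

Section Fps.
Variable R : fieldType.
Implicit Types (f g : fps R) (a b : nat -> R).

Definition fps_one : fps R := fun n => (n == 0%N)%:R.
Definition fps_X : fps R := fun n => (n == 1%N)%:R.

Definition fps_mul f g : fps R := fun n => \sum_(i < n.+1) f i * g (n - i)%N.

Definition fps_exp f (k : nat) : fps R := iter k (fps_mul f) fps_one.

(* f(g(t)) = \sum_k f_k g(t)^k, meaningful when g 0 = 0: then [t^n] g(t)^k    *)
(* vanishes for k > n (fps_exp_small), whence the bound on k.                 *)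
Definition fps_comp f g : fps R :=
  fun n => \sum_(k < n.+1) f k * fps_exp g k n.

Definition is_mul_inverse f g : Prop := fps_mul f g =1 fps_one.

Definition is_comp_inverse f g : Prop :=
  [/\ f 0%N = 0, g 0%N = 0, fps_comp f g =1 fps_X & fps_comp g f =1 fps_X].

(* A sequence (a_1, a_2, ...) is a function a : nat -> R with a j = a_j; the  *)
(* value a 0 is never used.                                                   *)

(* \sum_(j >= 1) a_j t^j / j! *)
Definition egf1 a : fps R := fun j => if j is 0 then 0 else a j / j`!%:R.

(* \sum_(j >= 0) b_(j+1) t^j / j! *)
Definition egfS b : fps R := fun j => b j.+1 / j`!%:R.

(* rBell r a b n k is B^(r)_(n+r, k+r)(a; b): the indices are not shifted by  *)
(* r here. It vanishes for n < k (rBell_small).                               *)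
Definition rBell (r : nat) a b (n k : nat) : R :=
  n`!%:R * (k`!%:R^-1 * fps_mul (fps_exp (egf1 a) k) (fps_exp (egfS b) r) n).

Lemma fps_exp_small f k n : f 0%N = 0 -> (n < k)%N -> fps_exp f k n = 0.
Proof.
move=> f0; elim: k n => // k IHk n ltnk; rewrite /fps_exp iterS.
apply: big1 => -[[|i] /= lti] _; first by rewrite f0 mul0r.
rewrite [iter _ _ _ _]IHk ?mulr0 // ltn_subLR // addSn ltnS.
by rewrite (leq_trans _ (leq_addl _ _)).
Qed.

Lemma rBell_small r a b n k : (n < k)%N -> rBell r a b n k = 0.
Proof.
move=> ltnk; rewrite /rBell /fps_mul big1 ?mulr0 // => i _.
by rewrite fps_exp_small ?mul0r // (leq_ltn_trans _ ltnk) // -ltnS.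
Qed.

End Fps.

(* Main.v *)
Require Import Defs.
From mathcomp Require Import all_boot all_order all_algebra.
From mathcomp Require Import reals ring.
Import Order.TTheory GRing.Theory Num.Theory.
Local Open Scope ring_scope.

Set Implicit Arguments.
Unset Strict Implicit.
Unset Printing Implicit Defensive.

(** With A, B, Abar, C the generating functions of a, b, abar, c, the product
    of the arrays in the order rBell abar c * rBell a b has (n, j) entry
    n!/j! [t^n] C^r ((A^j B^r) o Abar)
      = n!/j! [t^n] (A o Abar)^j ((B o Abar) C)^r = n!/j! [t^n] t^j,
    which only uses that f |-> f o Abar is multiplicative. The opposite order
    would need the associativity of composition; instead, it follows since
    one-sided inverses of finite square matrices are two-sided. Identities
    between series are transferred from polynomials, by truncation. *)

Section Triangular.
Variable R : comNzRingType.
Implicit Types (M N : nat -> nat -> R) (U V : nat -> R).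

Definition lower_triangular M := forall n k, (n < k)%N -> M n k = 0.

Definition left_inverse_array N M :=
  forall n j, \sum_(0 <= k < n.+1) N n k * M k j = (n == j)%:R.

(** Row [n] vanishes past the diagonal, so its sums, whose length depends on [n], all become sums of
    one length [m], as in products of [m] by [m] matrices. *)
Lemma lower_triangular_sum M (F : nat -> R) m n :
    lower_triangular M -> (n < m)%N ->
  \sum_(0 <= k < n.+1) M n k * F k = \sum_(k < m) M n k * F k.
Proof.
move=> trM ltnm; rewrite -(big_mkord xpredT (fun k => M n k * F k)).
rewrite [RHS](big_cat_nat (n := n.+1)) //= [X in _ + X]big_nat_cond.
by rewrite [X in _ + X]big1 ?addr0 // => k /andP[/andP[/trM -> _] _]; rewrite mul0r.
Qed.

Lemma left_inverse_array_sym M N :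
    lower_triangular M -> lower_triangular N ->
  left_inverse_array N M -> left_inverse_array M N.
Proof.
(* Both [n] and [j] must index the truncated matrices, and [j] may exceed [n]. *)
move=> trM trN NM n j; pose m := (maxn n j).+1.
have ltnm : (n < m)%N by rewrite ltnS leq_maxl.
have ltjm : (j < m)%N by rewrite ltnS leq_maxr.
pose A := \matrix_(i < m, k < m) N i k; pose B := \matrix_(i < m, k < m) M i k.
have /mulmx1C/matrixP/(_ (Ordinal ltnm) (Ordinal ltjm)) : A *m B = 1%:M.
  apply/matrixP => i k; rewrite !mxE -val_eqE /= -NM.
  rewrite (lower_triangular_sum _ trN (ltn_ord i)).
  by apply: eq_bigr => l _; rewrite !mxE.
rewrite !mxE -val_eqE /= => <-; rewrite (lower_triangular_sum _ trM ltnm).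
by apply: eq_bigr => l _; rewrite !mxE.
Qed.

Lemma left_inverse_array_solve M N U V :
    lower_triangular M -> left_inverse_array N M ->
    (forall n, U n = \sum_(0 <= k < n.+1) M n k * V k) ->
  forall n, V n = \sum_(0 <= k < n.+1) N n k * U k.
Proof.
move=> trM NM UE n; transitivity (\sum_(l < n.+1) (n == l)%:R * V l).
  rewrite big_ord_recr /= eqxx mul1r big1 ?add0r // => l _.
  by rewrite gtn_eqF ?mul0r.
under eq_bigr => l _ do rewrite -NM mulr_suml.
rewrite exchange_big /=; apply: eq_big_nat => k /andP[_ ltkn].
rewrite UE (lower_triangular_sum _ trM ltkn) mulr_sumr.
by apply: eq_bigr => l _; rewrite mulrA.
Qed.

End Triangular.

Section Truncation.
Variable R : fieldType.
Implicit Types (f g h : fps R) (p q : {poly R}).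

(** Congruence modulo t^N; the coefficients of [p] from [N] on are free, so products and
    compositions need no re-truncation. *)
Definition agree_below (N : nat) f p := forall n, (n < N)%N -> p`_n = f n.

Variable N : nat.

Lemma agree_below_poly f : agree_below N f (\poly_(i < N) f i).
Proof. by move=> n ltnN; rewrite coef_poly ltnN. Qed.

Lemma agree_below_ext f g p : f =1 g -> agree_below N f p -> agree_below N g p.
Proof. by move=> fg fp n /fp ->. Qed.

Lemma agree_below_one : agree_below N (fps_one R) 1.
Proof. by move=> n _; rewrite coef1. Qed.

Lemma agree_below_X : agree_below N (fps_X R) 'X.
Proof. by move=> n _; rewrite coefX. Qed.

Lemma agree_below_mul f g p q :
  agree_below N f p -> agree_below N g q -> agree_below N (fps_mul f g) (p * q).
Proof.
move=> fp gq n ltnN; rewrite coefM; apply: eq_bigr => i _.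
by rewrite fp ?gq //; apply: leq_ltn_trans ltnN; rewrite ?leq_subr // -ltnS.
Qed.

Lemma agree_below_exp f p k :
  agree_below N f p -> agree_below N (fps_exp f k) (p ^+ k).
Proof.
move=> fp; elim: k => [|k IHk]; first exact: agree_below_one.
by rewrite exprS; apply: agree_below_mul.
Qed.

(** Since [q] has no constant term, [q ^+ k * s] starts in degree at least [k], and only k <= n
    contributes. The factor [s] covers both plain composition ([s] = 1) and the weight [v ^+ r] of a
    Riordan array. *)
Lemma coef_comp_mul g f p q s n :
    g 0%N = 0 -> agree_below N g q -> agree_below N f p -> (n < N)%N ->
  ((p \Po q) * s)`_n = \sum_(k < n.+1) f k * (q ^+ k * s)`_n.
Proof.
move=> g0 gq fp ltnN.
have vanish k : (n < k)%N -> (q ^+ k * s)`_n = 0.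
  move=> ltnk; rewrite coefM big1 // => i _.
  have lein : (i <= n)%N by rewrite -ltnS.
  rewrite (agree_below_exp k gq) ?(leq_ltn_trans lein) //.
  by rewrite fps_exp_small ?mul0r // (leq_ltn_trans lein).
rewrite comp_polyE mulr_suml coef_sum.
under eq_bigr => k _ do rewrite -scalerAl coefZ.
pose F k := p`_k * (q ^+ k * s)`_n.
have eqF m : (size p <= m)%N -> \sum_(i < size p) F i = \sum_(i < m) F i.
  move=> lem; rewrite (big_ord_widen m F lem) [LHS]big_mkcond /=.
  apply: eq_bigr => i _; case: ltnP => // lei.
  by rewrite /F nth_default ?mul0r.
(* The bounds [size p] and [n.+1] are unrelated: both sums are extended to the larger one, by zero
   coefficients of [p] on one side and by [vanish] on the other. *)
rewrite (eqF (maxn (size p) n.+1)) ?leq_maxl //.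
transitivity (\sum_(k < n.+1) F k).
  rewrite [RHS](big_ord_widen (maxn (size p) n.+1) F) ?leq_maxr // [RHS]big_mkcond.
  by apply: eq_bigr => i _; case: ltnP => // /vanish; rewrite /F => ->; rewrite mulr0.
by apply: eq_bigr => k _; rewrite /F fp // (leq_trans (ltn_ord k)).
Qed.

Lemma agree_below_comp f g p q :
    g 0%N = 0 -> agree_below N f p -> agree_below N g q ->
  agree_below N (fps_comp f g) (p \Po q).
Proof.
move=> g0 fp gq n ltnN; rewrite -[p \Po q]mulr1 (coef_comp_mul _ g0 gq fp) //.
by apply: eq_bigr => k _; rewrite mulr1 (agree_below_exp k gq).
Qed.

End Truncation.

Lemma riordan_left_inverse (R : fieldType) (f fbar g h : fps R) (r n j : nat) :
    fbar 0%N = 0 -> fps_comp f fbar =1 fps_X R ->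
    is_mul_inverse (fps_comp g fbar) h ->
  \sum_(k < n.+1) fps_mul (fps_exp f j) (fps_exp g r) k *
                  fps_mul (fps_exp fbar k) (fps_exp h r) n = (n == j)%:R.
Proof.
move=> fbar0 ffbar gh; have ag := @agree_below_poly R n.+1.
move: (ag f) (ag fbar) (ag g) (ag h).
move: (\poly_(i < _) f i) (\poly_(i < _) fbar i) => p q.
move: (\poly_(i < _) g i) (\poly_(i < _) h i) => u v fp fq gu hv.
have E := coef_comp_mul (v ^+ r) fbar0 fq
  (agree_below_mul (agree_below_exp j fp) (agree_below_exp r gu)) (ltnSn n).
transitivity ((((p ^+ j * u ^+ r) \Po q) * v ^+ r)`_n).
  rewrite E; apply: eq_bigr => k _; congr (_ * _).
  by rewrite (agree_below_mul (agree_below_exp k fq) (agree_below_exp r hv)).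
(* Composition with [q] is a ring morphism on polynomials, so the coefficient is that of (p o q)^j
   ((u o q) v)^r. *)
rewrite comp_polyM !rmorphXn /= -mulrA -exprMn.
have pX := agree_below_ext ffbar (agree_below_comp fbar0 fp fq).
have uv1 := agree_below_ext gh (agree_below_mul (agree_below_comp fbar0 gu fq) hv).
rewrite (agree_below_mul (agree_below_exp j pX) (agree_below_exp r uv1)) //.
have X1 := agree_below_mul (agree_below_exp j (@agree_below_X R n.+1))
                           (agree_below_exp r (@agree_below_one R n.+1)).
by rewrite -X1 // expr1n mulr1 coefXn.
Qed.

Lemma rBell_left_inverse (R : numFieldType) (r : nat) (a abar b c : nat -> R) :
    fps_comp (egf1 a) (egf1 abar) =1 fps_X R ->
    is_mul_inverse (fps_comp (egfS b) (egf1 abar)) (egfS c) ->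
  left_inverse_array (rBell r abar c) (rBell r a b).
Proof.
move=> aabar bc n j; rewrite big_mkord.
have fact_neq0 m : m`!%:R != 0 :> R by rewrite pnatr_eq0 -lt0n fact_gt0.
(* The factorials of the summation index k cancel, leaving n!/j!, which is 1 on the diagonal. *)
transitivity (n`!%:R / j`!%:R * (n == j)%:R : R); last first.
  by case: eqP => [->|_]; rewrite ?mulr0 // mulr1 divff.
rewrite -(riordan_left_inverse (h := egfS c) r n j (erefl _) aabar bc) mulr_sumr.
apply: eq_bigr => k _; rewrite /rBell.
by field; rewrite !fact_neq0.
Qed.

Theorem theorem1 (R : realType) (r : nat) (a abar b c : nat -> R)
    (a1_neq0 : a 1%N != 0)
    (abarP : is_comp_inverse (egf1 a) (egf1 abar))
    (b1_neq0 : b 1%N != 0)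
    (cP : is_mul_inverse (fps_comp (egfS b) (egf1 abar)) (egfS c)) :
  (forall U V : nat -> R,
      (forall n : nat, U n = \sum_(0 <= k < n.+1) rBell r a b n k * V k) <->
      (forall n : nat, V n = \sum_(0 <= k < n.+1) rBell r abar c n k * U k)) /\
  (forall j n : nat, (j <= n)%N ->
      \sum_(j <= k < n.+1) rBell r a b n k * rBell r abar c k j = (j == n)%:R).
Proof.
have [_ _ aabar _] := abarP.
have NM := rBell_left_inverse r aabar cP.
have trM : lower_triangular (rBell r a b) by move=> n k; apply: rBell_small.
have trN : lower_triangular (rBell r abar c) by move=> n k; apply: rBell_small.
have MN := left_inverse_array_sym trM trN NM.
split=> [U V | j n lejn].
  by split; [apply: left_inverse_array_solve trM NM | apply: left_inverse_array_solve trN MN].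
(* The full sum from 0 is split at [j]; its terms with k < j vanish because the second array is
   lower triangular. *)
rewrite eq_sym -MN [RHS](big_cat_nat (n := j)) ?(leqW lejn) //=.
rewrite [X in X + _]big_nat_cond [X in X + _]big1 ?add0r // => k /andP[/andP[_ ltkj] _].
by rewrite trN ?mulr0.
Qed.
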